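(* Let $\theta>0$, $t>0$ and $k\in\mathbb{N}$. The following identity holds: $$\sum_{N=1}^\infty\sum_\lambda F_{N,k}(\lambda)\,e^{-(N+t)\theta}\,\frac{\theta^{|\lambda|}}{|\lambda|!}\,\frac{(t\theta)^{N-1}}{(N-1)!}\,s_\lambda(1^N)\,f^\lambda=\theta^k\;{}_2F_1\left(\begin{matrix}-k,-k\\ 2\end{matrix};t\right),$$ where the inner sum is over all integer partitions $\lambda$ (the terms with $\lambda$ having more than $N$ parts being $0$, since then $s_\lambda(1^N)=0$).
   Context: Conventions: $\mathbb{N}=\{0,1,2,\dots\}$; an empty product is $1$. For an integer partition $\lambda$, $|\lambda|=\sum_i\lambda_i$; $s_\lambda(x_1,\dots,x_N)$ is the Schur polynomial in $N$ variables, $s_\lambda(1^N)=s_\lambda(1,\dots,1)$ ($N$ ones), and $f^\lambda$ is the number of standard Young tableaux of shape $\lambda$. For $\lambda$ with at most $N$ parts (padded by zeros to length $N$), $$F_{N,k}(\lambda)=\frac1N\sum_{i=1}^N(\lambda_i+N-i)(\lambda_i+N-i-1)\cdots(\lambda_i+N-i-k+1).$$ Hypergeometric notation: $(a)_i=a(a+1)\cdots(a+i-1)$ and ${}_2F_1\left(\begin{matrix}a,b\\ c\end{matrix};z\right)=\sum_{i\ge0}\frac{(a)_i(b)_i}{(c)_i}\frac{z^i}{i!}$, which terminates if $a$ or $b$ is a nonpositive integer. *)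

(* Defs.v *)
From HB Require Import structures.
From mathcomp Require Import all_boot all_order all_algebra.
From mathcomp Require Import all_classical all_reals all_analysis.
(* The notations of mpoly clash with those of mathcomp-analysis. *)
From mathcomp Require Import -(notations) mpoly.

Set Implicit Arguments.
Unset Strict Implicit.
Unset Printing Implicit Defensive.

Import Order.TTheory GRing.Theory Num.Theory.
Import numFieldNormedType.Exports.

Local Open Scope ring_scope.

(* Trailing zeros are excluded, so each integer partition is exactly one
   sequence; its length is [size l], its weight [sumn l], and its i-th part,
   padded by zeros, is [nth 0 l i] (i counted from 0). *)
Definition is_part (l : seq nat) : bool := sorted geq l && (0%N \notin l).

Definition cell (l : seq nat) : finType := {i : 'I_(size l) & 'I_(nth 0%N l i)}.

Definition cell_row (l : seq nat) (c : cell l) : nat := tag c.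
Definition cell_col (l : seq nat) (c : cell l) : nat := tagged c.

Definition is_ssyt (N : nat) (l : seq nat) (T : {ffun cell l -> 'I_N}) : bool :=
  [forall c : cell l, forall d : cell l,
    ((cell_row c == cell_row d) && (cell_col c < cell_col d)%N
       ==> (T c <= T d)%N) &&
    ((cell_col c == cell_col d) && (cell_row c < cell_row d)%N
       ==> (T c < T d)%N)].

(* Entries are 0, ..., |l| - 1 instead of 1, ..., |l|; each is used exactly once,
   since T is injective and there are |l| cells. *)
Definition is_syt (l : seq nat) (T : {ffun cell l -> 'I_(sumn l)}) : bool :=
  injectiveb T &&
  [forall c : cell l, forall d : cell l,
    ((cell_row c == cell_row d) && (cell_col c < cell_col d)%N
       ==> (T c < T d)%N) &&
    ((cell_col c == cell_col d) && (cell_row c < cell_row d)%N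
       ==> (T c < T d)%N)].

Definition nb_syt (l : seq nat) : nat :=
  #|[set T : {ffun cell l -> 'I_(sumn l)} | is_syt T]|.

Definition schur (R : comNzRingType) (N : nat) (l : seq nat) : mpoly.mpoly N R :=
  \sum_(T : {ffun cell l -> 'I_N} | is_ssyt T)
    \prod_(c : cell l) mpoly.mpolyX R (mpoly.mnm1 (T c)).

Definition schur1 (R : comNzRingType) (N : nat) (l : seq nat) : R :=
  mpoly.meval (fun _ : 'I_N => 1) (schur R N l).

(* With i counted from 0, lambda_i + N - i becomes nth 0 l i + (N - i.+1); the
   natural-number falling factorial [n ^_ k] is 0 when k > n, as is the product
   n (n - 1) ... (n - k + 1) over the integers. *)
Definition factorial_mean (R : fieldType) (N k : nat) (l : seq nat) : R :=
  N%:R^-1 * \sum_(i < N) ((nth 0%N l i + (N - i.+1)) ^_ k)%:R.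

Definition rising (R : pzSemiRingType) (a : R) (i : nat) : R :=
  \prod_(j < i) (a + j%:R).

Definition hyp2F1 (R : realType) (a b c z : R) : R :=
  limn (series (fun i : nat =>
    rising a i * rising b i / rising c i * (z ^+ i / i`!%:R))).

(* Main.v *)
Require Import Defs.
From mathcomp Require Import all_boot all_order all_algebra.
From mathcomp Require Import all_classical all_reals all_analysis.
From mathcomp Require Import perm zify ring.
(* Activates the canonical instances of mpoly, whose notations clash with those
   of mathcomp-analysis. *)
From mathcomp Require Import -(notations) mpoly.

(** For a partition l with at most N parts put x_i = l_i + N - i and
    W(x) = det C(x_i, N - j), both 1-based.

    Removing the largest entry of a tableau removes a horizontal strip from its
    shape.  For semistandard tableaux this is the Gelfand-Tsetlin recursion, which
    W satisfies (subtract consecutive rows), so s_l(1^N) = W(x).  For standard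
    tableaux it makes A_n(phi) = sum_{|l| = n} f^l phi(x) satisfy
    A_{n+1}(phi) = A_n(sum_i phi(. + e_i)) whenever phi vanishes on points with a
    repeated coordinate: such a phi does not see the steps leaving the set of
    partitions.

    The functions psi_{m,p}(x) = sum_i x_i^_m W(x + p e_i), with ^_ the falling
    factorial, have this property.  Since sum_i W(x + e_i) = N W(x),
      sum_i psi_{m,p}(x + e_i) = N psi_{m,p}(x) + m psi_{m-1,p+1}(x),
    which gives A_n(psi_{k,0}), with psi_{k,0} = W * sum_i x_i^_k, as a combination
    of the values psi_{k-r,r}(delta) at the empty partition.  Those are traces,
    because the rows (x_i^_m C(x_i + p, N - j))_j are the rows of a product M Z with
    M = (C(x_i, N - j)): psi_{k-r,r}(delta) = C(k,r) sum_{s<N} s^_(k-r).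

    It remains to sum over n and N with sum_n x^n/n! n^_r = x^r e^x. *)

Set Implicit Arguments.
Unset Strict Implicit.
Unset Printing Implicit Defensive.

Import Order.TTheory GRing.Theory Num.Theory.
Import numFieldNormedType.Exports.

(** * Tableaux as fillings *)

Section Fillings.
Implicit Types (l : seq nat) (N : nat).

Lemma cell_col_lt l (c : cell l) : cell_col c < nth 0 l (cell_row c).
Proof. by case: c => i j; exact: ltn_ord. Qed.

Lemma cell_exists l i j :
  j < nth 0 l i -> exists c : cell l, cell_row c = i /\ cell_col c = j.
Proof.
move=> hj.
have hi : i < size l.
  by rewrite ltnNge; apply/negP => h; rewrite nth_default in hj.
by exists (Tagged (fun i : 'I_(size l) => 'I_(nth 0 l i)) (Ordinal hj : 'I_(nth 0 l (Ordinal hi)))).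
Qed.

Lemma cell_inj l (c d : cell l) :
  cell_row c = cell_row d -> cell_col c = cell_col d -> c = d.
Proof.
case: c d => i j [i' j'] ei; have {}ei : i = i' := val_inj ei.
by move: j'; rewrite -ei => j' ej; have -> : j = j' := val_inj ej.
Qed.

(* Junk value 0 outside the shape. *)
Definition entry l N (T : {ffun cell l -> 'I_N}) (i j : nat) : nat :=
  if [pick c : cell l | (cell_row c == i) && (cell_col c == j)] is Some c
  then T c else 0.

Lemma entryE l N (T : {ffun cell l -> 'I_N}) c :
  entry T (cell_row c) (cell_col c) = T c.
Proof.
rewrite /entry; case: pickP => [d /andP[/eqP h1 /eqP h2]|/(_ c)].
  by rewrite (cell_inj h1 h2).
by rewrite !eqxx.
Qed.

Lemma entry_lt l N (T : {ffun cell l -> 'I_N}) i j :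
  j < nth 0 l i -> entry T i j < N.
Proof. by move=> /cell_exists[c [<- <-]]; rewrite entryE ltn_ord. Qed.

Definition fill l N (f : nat -> nat -> nat)
    (fN : forall c : cell l, f (cell_row c) (cell_col c) < N) :
    {ffun cell l -> 'I_N} :=
  [ffun c => Ordinal (fN c)].

Lemma entry_fill l N f (fN : forall c : cell l, f (cell_row c) (cell_col c) < N) i j :
  j < nth 0 l i -> entry (fill fN) i j = f i j.
Proof. by move=> /cell_exists[c [<- <-]]; rewrite entryE ffunE. Qed.

Lemma entry_inj l N (T U : {ffun cell l -> 'I_N}) :
  (forall i j, j < nth 0 l i -> entry T i j = entry U i j) -> T = U.
Proof.
move=> h; apply/ffunP => c; apply/val_inj.
by rewrite /= -(entryE T) -(entryE U) h // cell_col_lt.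
Qed.

(** Plain functions and row lengths allow fillings of different shapes and alphabets to be compared
    without transporting dependent types. *)
Definition semistd (h : nat -> nat) (f : nat -> nat -> nat) : Prop :=
  (forall i j j', j < j' -> j' < h i -> f i j <= f i j') /\
  (forall i i' j, i < i' -> j < h i -> j < h i' -> f i j < f i' j).

Lemma is_ssytP l N (T : {ffun cell l -> 'I_N}) :
  reflect (semistd (nth 0 l) (entry T)) (is_ssyt T).
Proof.
apply: (iffP forallP) => [h|[h1 h2] c].
  split=> [i j j' jj' j'i|i i' j ii' ji ji'].
    have [c [ci cj]] := cell_exists (ltn_trans jj' j'i).
    have [d [di dj]] := cell_exists j'i.
    move/forallP: (h c) => /(_ d) /andP[].
    by rewrite ci cj di dj eqxx jj' /= -!entryE ci cj di dj.
  have [c [ci cj]] := cell_exists ji.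
  have [d [di dj]] := cell_exists ji'.
  move/forallP: (h c) => /(_ d) /andP[_].
  by rewrite ci cj di dj eqxx ii' /= -!entryE ci cj di dj.
apply/forallP => d; apply/andP; split; apply/implyP => /andP[/eqP e lt].
  by rewrite -!entryE e; apply: h1 lt (cell_col_lt d).
by rewrite -!entryE e; apply: h2 lt _ (cell_col_lt d); rewrite -e cell_col_lt.
Qed.

(** The row bound [s] may exceed the length of the shape, so that one [s] serves two shapes at
    once. *)
Definition content (h : nat -> nat) (f : nat -> nat -> nat) (s v : nat) : nat :=
  \sum_(0 <= i < s) \sum_(0 <= j < h i) (f i j == v).

Lemma sum_cells l (F : nat -> nat -> nat) s : size l <= s ->
  \sum_(c : cell l) F (cell_row c) (cell_col c)
    = \sum_(0 <= i < s) \sum_(0 <= j < nth 0 l i) F i j.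
Proof.
move=> ls; rewrite (big_cat_nat (n := size l)) //= [X in _ + X]big1_seq ?addn0.
  rewrite big_mkord [RHS](eq_bigr (fun i : 'I_(size l) => \sum_(j < nth 0 l i) F i j)).
    by rewrite (@sig_big_dep _ _ _ _ (fun i : 'I_(size l) => 'I_(nth 0 l i) : finType)
      xpredT (fun _ => xpredT) (fun i j => F i j)).
  by move=> i _; rewrite big_mkord.
by move=> i; rewrite mem_index_iota => /and3P[_ hi _]; rewrite nth_default // big_geq.
Qed.

Lemma card_content l N (T : {ffun cell l -> 'I_N}) (v : 'I_N) s : size l <= s ->
  #|[set c | T c == v]| = content (nth 0 l) (entry T) s v.
Proof.
move=> ls; rewrite /content -(sum_cells _ ls) -sum1dep_card big_mkcond /=.
by apply: eq_bigr => c _; rewrite entryE -val_eqE /=; case: eqP.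
Qed.

Lemma card_cell l : #|{: cell l}| = sumn l.
Proof.
rewrite -sum1_card (sum_cells (fun _ _ => 1) (leqnn _)).
rewrite sumnE [RHS](big_nth 0); apply: eq_bigr => i _.
by rewrite sum_nat_const_nat subn0 muln1.
Qed.

(** [P] restricts the multiplicity of every entry: [xpredT] gives all semistandard tableaux, and
    [pred1 1] with [N = sumn l] the standard ones, so one branching rule serves both. *)
Definition ssyt_count (P : pred nat) N l : nat :=
  #|[set T : {ffun cell l -> 'I_N} |
      is_ssyt T && [forall v, P #|[set c | T c == v]|]]|.

Definition semistd_fill (P : pred nat) N s (h : nat -> nat) (f : nat -> nat -> nat) : Prop :=
  semistd h f /\ forall v, v < N -> P (content h f s v).

Lemma in_ssytP P N l s (T : {ffun cell l -> 'I_N}) : size l <= s ->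
  reflect (semistd_fill P N s (nth 0 l) (entry T))
    (T \in [set T : {ffun cell l -> 'I_N} |
      is_ssyt T && [forall v, P #|[set c | T c == v]|]]).
Proof.
move=> ls; rewrite inE; apply: (iffP andP) => -[/is_ssytP h1 h2]; split=> //.
  by move=> v vN; move/forallP: h2 => /(_ (Ordinal vN)); rewrite (card_content _ _ ls).
by apply/forallP => v; rewrite (card_content _ _ ls) h2.
Qed.

Lemma eq_semistd h h' f f' :
  h =1 h' -> (forall i j, j < h i -> f i j = f' i j) ->
  semistd h f -> semistd h' f'.
Proof.
move=> eh ef [h1 h2]; split=> [i j j' jj' j'i|i i' j ii' ji ji'].
  rewrite -!ef ?eh // ?(ltn_trans jj') //; apply: h1; rewrite ?eh //.
by rewrite -!ef ?eh //; apply: h2; rewrite ?eh.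
Qed.

Lemma eq_content h h' f f' s v :
  h =1 h' -> (forall i j, j < h i -> f i j = f' i j) ->
  content h f s v = content h' f' s v.
Proof.
move=> eh ef; apply: eq_bigr => i _; rewrite -eh.
by apply: eq_big_nat => j /andP[_ /ef->].
Qed.

Lemma eq_semistd_fill P N s h h' f f' :
  h =1 h' -> (forall i j, j < h i -> f i j = f' i j) ->
  semistd_fill P N s h f -> semistd_fill P N s h' f'.
Proof.
move=> eh ef [h1 h2]; split; first exact: eq_semistd ef h1.
by move=> v /h2; rewrite (eq_content _ _ eh ef).
Qed.

Lemma eq_ssyt_count P N l l' : nth 0 l =1 nth 0 l' ->
  ssyt_count P N l = ssyt_count P N l'.
Proof.
(* By symmetry one inequality suffices; it comes from the injection that copies entries into the
   other cell type. *)
wlog: l l' / ssyt_count P N l' <= ssyt_count P N l.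
  move=> H e; case: (leqP (ssyt_count P N l') (ssyt_count P N l)) => h.
    exact: H h e.
  by symmetry; apply: H (ltnW h) _ => i; rewrite e.
move=> le e; apply/eqP; rewrite eqn_leq le andbT {le}.
have lt (T : {ffun cell l -> 'I_N}) (c : cell l') :
    entry T (cell_row c) (cell_col c) < N.
  by apply: entry_lt; rewrite e cell_col_lt.
pose g T := fill (lt T).
have ge T i j : j < nth 0 l i -> entry (g T) i j = entry T i j.
  by move=> h; rewrite entry_fill // -e.
have g_inj : injective g.
  by move=> T U gTU; apply: entry_inj => i j h; rewrite -!ge // gTU.
rewrite /ssyt_count -[X in X <= _](card_imset _ g_inj); apply: subset_leq_card.
apply/fintype.subsetP => _ /imsetP[T hT ->].
apply/(in_ssytP _ _ (leq_maxr (size l) (size l'))).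
move/(in_ssytP _ _ (leq_maxl (size l) (size l'))): hT.
by apply: eq_semistd_fill => // i j h; rewrite ge.
Qed.

End Fillings.

(** * Removal of the largest entry *)

Section Branching.

Definition rowseq r B (m : {ffun 'I_r -> 'I_B}) : seq nat :=
  [seq nat_of_ord (m i) | i <- enum 'I_r].

Lemma size_rowseq r B (m : {ffun 'I_r -> 'I_B}) : size (rowseq m) = r.
Proof. by rewrite size_map size_enum_ord. Qed.

Lemma nth_rowseq r B (m : {ffun 'I_r -> 'I_B}) (i : 'I_r) : nth 0 (rowseq m) i = m i.
Proof. by rewrite (nth_map i) ?size_enum_ord // nth_ord_enum. Qed.

Lemma nth_rowseq_default r B (m : {ffun 'I_r -> 'I_B}) i :
  r <= i -> nth 0 (rowseq m) i = 0.
Proof. by move=> h; rewrite nth_default // size_rowseq. Qed.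

Lemma sumn_nth l s : size l <= s -> sumn l = \sum_(0 <= i < s) nth 0 l i.
Proof.
move=> ls; rewrite sumnE (big_nth 0) [RHS](big_cat_nat (n := size l)) //=.
rewrite [X in _ = _ + X]big1_seq ?addn0 // => i.
by rewrite mem_index_iota => /and3P[_ hi _]; rewrite nth_default.
Qed.

Lemma sumn_rowseq r B (m : {ffun 'I_r -> 'I_B}) : sumn (rowseq m) = \sum_i m i.
Proof. by rewrite sumnE big_map big_enum. Qed.

(** The entries below [N] of a weakly increasing row form an initial segment, and [find] returns its
    length. *)
Lemma find_cut (f : nat -> nat) N L :
  (forall j j', j < j' -> j' < L -> f j <= f j') ->
  let m := find (fun j => N <= f j) (iota 0 L) in
  m <= L /\ forall j, j < L -> (f j < N) = (j < m).
Proof.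
move=> mono m.
have mL : m <= L by rewrite -[L in _ <= L](size_iota 0) find_size.
split=> // j jL; case: (ltnP j m) => [jm|mj].
  have := before_find 0 jm; rewrite nth_iota // add0n => /negbT.
  by rewrite -ltnNge => ->.
have hm : has (fun j => N <= f j) (iota 0 L).
  by rewrite has_find size_iota -/m; apply: leq_ltn_trans jL.
have := nth_find 0 hm; rewrite -/m nth_iota ?add0n; last exact: leq_ltn_trans jL.
move=> Nm; apply/negbTE; rewrite -leqNgt; apply: leq_trans Nm _.
by move: mj; rewrite leq_eqVlt => /predU1P[->//|/mono]; apply.
Qed.

Variables (P : pred nat) (N s : nat) (h g : nat -> nat).
(** Interlacing: [h / g] is a horizontal strip, the region that the value [N] occupies. *)
Hypothesis gh : forall i, h i.+1 <= g i <= h i.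

Let gleh i : g i <= h i. Proof. by case/andP: (gh i). Qed.

Let h_g i i' : i < i' -> h i' <= g i.
Proof.
elim: i' => // i' IH; rewrite ltnS leq_eqVlt => /predU1P[->|/IH].
  by case/andP: (gh i').
by apply: leq_trans; apply: leq_trans (gleh _); case/andP: (gh i').
Qed.

Lemma content_cut f v : v < N -> (forall i j, j < h i -> (f i j < N) = (j < g i)) ->
  content h f s v = content g f s v.
Proof.
move=> vN cut; apply: eq_bigr => i _.
rewrite (big_cat_nat (n := g i)) //= [X in _ + X]big1_seq ?addn0 // => j.
rewrite mem_index_iota => /and3P[_ gj jh]; apply/eqP; rewrite eqb0.
apply: contraL gj => /eqP fv; rewrite -ltnNge -cut // fv //.
Qed.

Lemma content_top f : (forall i j, j < h i -> (f i j < N) = (j < g i)) ->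
  (forall i j, j < h i -> f i j < N.+1) ->
  content h f s N = \sum_(0 <= i < s) h i - \sum_(0 <= i < s) g i.
Proof.
move=> cut fN; rewrite -sumnB => [|i _]; last exact: gleh.
apply: eq_bigr => i _; rewrite (big_cat_nat (n := g i)) //=.
rewrite big1_seq ?add0n => [|j].
  rewrite -[RHS]muln1 -sum_nat_const_nat; apply: eq_big_nat => j /andP[gj jh].
  by apply/eqP; rewrite eqb1 eqn_leq -ltnS fN // leqNgt cut // -leqNgt.
rewrite mem_index_iota => /and3P[_ _ jg]; apply/eqP; rewrite eqb0.
by rewrite neq_ltn cut ?jg // (leq_trans jg).
Qed.

Lemma semistd_fill_restrict f :
  (forall i j, j < h i -> (f i j < N) = (j < g i)) ->
  semistd_fill P N.+1 s h f -> semistd_fill P N s g f.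
Proof.
move=> cut [[h1 h2] h3]; split; last first.
  by move=> v vN; rewrite -content_cut // h3 // ltnW.
split=> [i j j' jj' j'i|i i' j ii' ji ji'].
  by apply: h1 => //; apply: leq_trans j'i _.
by apply: h2 => //; [apply: leq_trans ji _|apply: leq_trans ji' _].
Qed.

Definition extend f i j := if j < g i then f i j else N.

Lemma extend_cut f : (forall i j, j < g i -> f i j < N) ->
  forall i j, (extend f i j < N) = (j < g i).
Proof. by move=> fN i j; rewrite /extend; case: ifP => [/fN//|]; rewrite ltnn. Qed.

(** Columns stay strict because a horizontal strip has at most one cell per column: by [h_g], every
    cell above a cell of [h] lies in [g]. *)
Lemma semistd_fill_extend f :
  (forall i j, j < g i -> f i j < N) ->
  P (\sum_(0 <= i < s) h i - \sum_(0 <= i < s) g i) ->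
  semistd_fill P N s g f -> semistd_fill P N.+1 s h (extend f).
Proof.
move=> fN PN [[h1 h2] h3]; have cut := extend_cut fN.
have efN i j : extend f i j < N.+1.
  by rewrite /extend; case: ifP => // /fN /ltnW.
split; last first.
  move=> v; rewrite ltnS leq_eqVlt => /predU1P[->|vN]; first by rewrite content_top.
  rewrite content_cut // (eq_content (f' := f) _ _ (fun=> erefl)) ?h3 //.
  by move=> i j; rewrite /extend => ->.
split=> [i j j' jj' j'i|i i' j ii' ji ji']; rewrite /extend.
  case: (ltnP j' (g i)) => [j'g|gj'].
    by rewrite (ltn_trans jj' j'g) h1.
  by case: ifP => // /fN /ltnW.
have jg : j < g i by apply: leq_trans ji' (h_g ii').
by rewrite jg; case: ifP => [jg'|_]; [exact: h2|exact: fN].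
Qed.

End Branching.

Definition strip l r B (m : {ffun 'I_r -> 'I_B}) : bool :=
  [forall i : 'I_r, nth 0 l i.+1 <= m i <= nth 0 l i].

(** The cells with entry below [N] form a tableau of some shape [m], and the cells equal to [N] form
    the strip [l / m]; conversely every such strip can be filled with [N]. Recording [r] rows of [m]
    suffices, because row [r] of [l] is empty or, when [N <= r], filled with [N] alone. *)
Lemma ssyt_count_branch P N r B l :
  (forall i, nth 0 l i.+1 <= nth 0 l i) -> (forall i, r < i -> nth 0 l i = 0) ->
  nth 0 l r = 0 \/ N <= r -> nth 0 l 0 <= B ->
  ssyt_count P N.+1 l =
  \sum_(m : {ffun 'I_r -> 'I_B.+1} | strip l m && P (sumn l - sumn (rowseq m)))
     ssyt_count P N (rowseq m).
Proof.
move=> l_noninc lr0 lrN lB.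
have lB' i : nth 0 l i < B.+1.
  by rewrite ltnS; elim: i => // i IH; apply: leq_trans (l_noninc i) IH.
pose s := maxn (size l) r.
have sl : size l <= s by exact: leq_maxl.
have ss (m : {ffun 'I_r -> 'I_B.+1}) : size (rowseq m) <= s by rewrite size_rowseq leq_maxr.
pose A := [set T : {ffun cell l -> 'I_N.+1} |
  is_ssyt T && [forall v, P #|[set c | T c == v]|]].
pose cut (T : {ffun cell l -> 'I_N.+1}) : {ffun 'I_r -> 'I_B.+1} :=
  [ffun i : 'I_r => inord (find (fun j => N <= entry T i j) (iota 0 (nth 0 l i)))].
have cutE T i : T \in A -> i < r ->
    nth 0 (rowseq (cut T)) i = find (fun j => N <= entry T i j) (iota 0 (nth 0 l i)).
  move=> /(in_ssytP _ _ sl)[[h1 _] _] ir.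
  rewrite (nth_rowseq _ (Ordinal ir)) ffunE inordK //=.
  by case: (find_cut N (h1 i)) => le _; apply: leq_ltn_trans le (lB' _).
have top T i j : T \in A -> r <= i -> j < nth 0 l i -> (entry T i j < N) = false.
  move=> /(in_ssytP _ _ sl)[[_ h2] _] ri ji.
  have {}ri : r = i.
    by apply/eqP; rewrite eqn_leq ri leqNgt; apply/negP => /lr0 e; rewrite e in ji.
  subst i; case: lrN => [e|Nr]; first by rewrite e in ji.
  apply/negbTE; rewrite -leqNgt; apply: leq_trans Nr _.
  (* Strict columns force the entries of row [i] to be at least [i]. *)
  have : forall i, i <= r -> i <= entry T i j; last by apply.
  elim=> // i IH ir; apply: leq_ltn_trans (IH (ltnW ir)) _.
  apply: h2 => //; apply: leq_trans ji _; last first.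
    elim: r ir {IH lr0 s sl ss cut cutE} => // r' IH; rewrite ltnS leq_eqVlt.
    by move=> /predU1P[->//|/IH]; apply: leq_trans (l_noninc _).
  elim: r ir {IH lr0 s sl ss cut cutE} => // r' IH; rewrite ltnS leq_eqVlt.
  by move=> /predU1P[->//|/IH]; apply: leq_trans (l_noninc _).
have cutP T i j : T \in A -> j < nth 0 l i ->
    (entry T i j < N) = (j < nth 0 (rowseq (cut T)) i).
  move=> TA ji; case: (ltnP i r) => [ir|ri]; last by rewrite nth_rowseq_default ?top.
  rewrite cutE //; case/(in_ssytP _ _ sl): TA => -[h1 _] _.
  by case: (find_cut N (h1 i)) => _; apply.
have cut_strip T i : T \in A -> nth 0 l i.+1 <= nth 0 (rowseq (cut T)) i <= nth 0 l i.
  move=> TA; case: (ltnP i r) => [ir|ri]; last by rewrite nth_rowseq_default // lr0.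
  case/(in_ssytP _ _ sl): (TA) => -[h1 h2] _.
  have := find_cut N (h1 i); rewrite -cutE // => -[le _].
  rewrite le andbT leqNgt; apply/negP => lt.
  (* Otherwise the entry of row [i] at the cut is already at least [N], and the cell below it would
     need more than [N]. *)
  have lt' := leq_trans lt (l_noninc i).
  have := cutP _ _ _ TA lt'; rewrite ltnn => /negbT; rewrite -leqNgt => hN.
  have := h2 i i.+1 _ (ltnSn i) lt' lt; rewrite ltnNge => /negP; apply.
  by apply: leq_trans hN; rewrite -ltnS entry_lt.
clearbody cut; rewrite {1}/ssyt_count -/A -sum1_card.
rewrite (partition_big cut (fun m => strip l m && P (sumn l - sumn (rowseq m)))); last first.
  move=> T TA; apply/andP; split.
    by apply/forallP => i; rewrite -nth_rowseq cut_strip.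
  rewrite (sumn_nth sl) (sumn_nth (ss _)).
  rewrite -(content_top s (fun i => cut_strip T i TA) (fun i j => cutP T i j TA) (@entry_lt _ _ T)).
  by case/(in_ssytP _ _ sl): TA => _; apply.
apply: eq_bigr => m /andP[/forallP mstrip mP]; rewrite sum1_card.
have gh i : nth 0 l i.+1 <= nth 0 (rowseq m) i <= nth 0 l i.
  case: (ltnP i r) => [ir|ri]; first by rewrite (nth_rowseq m (Ordinal ir)) mstrip.
  by rewrite nth_rowseq_default // lr0.
have ext_lt (T : {ffun cell (rowseq m) -> 'I_N}) (c : cell l) :
    extend N (nth 0 (rowseq m)) (entry T) (cell_row c) (cell_col c) < N.+1.
  by rewrite /extend; case: ifP => // /(entry_lt T) /ltnW.
pose ext T := fill (ext_lt T).
have extE T i j : j < nth 0 l i -> entry (ext T) i j = extend N (nth 0 (rowseq m)) (entry T) i j.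
  by move=> ji; rewrite entry_fill.
have ext_inj : injective ext.
  move=> T U e; apply: entry_inj => i j ji.
  have ji' : j < nth 0 l i by apply: leq_trans ji _; case/andP: (gh i).
  by have := extE T i j ji'; rewrite e extE // /extend ji.
(* The fibre over [m] is the image of the tableaux of shape [m] under extension by [N]. *)
rewrite /ssyt_count -[RHS](card_imset _ ext_inj); apply: eq_card => T.
apply/idP/imsetP => [/andP[TA /eqP cutT]|[U UA ->]].
  have lt (c : cell (rowseq m)) : entry T (cell_row c) (cell_col c) < N.
    rewrite cutP //; first by rewrite cutT cell_col_lt.
    by apply: leq_trans (cell_col_lt c) _; case/andP: (gh (cell_row c)).
  exists (fill lt).
    apply/(in_ssytP _ _ (ss m)).
    have : semistd_fill P N s (nth 0 (rowseq m)) (entry T).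
      apply: (semistd_fill_restrict gh); last exact/(in_ssytP _ _ sl).
      by move=> i j ji; rewrite cutP // cutT.
    by apply: eq_semistd_fill => // i j ji; rewrite entry_fill.
  apply: entry_inj => i j ji; have e := cutP T i j TA ji.
  rewrite cutT in e; rewrite extE // /extend -e.
  case: ifP => [lN|/negbT]; first by rewrite entry_fill // -e.
  by rewrite -leqNgt => Nle; apply/eqP; rewrite eqn_leq Nle -ltnS entry_lt.
have lt i j : j < nth 0 (rowseq m) i -> entry U i j < N by exact: entry_lt.
have extA : ext U \in A.
  apply/(in_ssytP _ _ sl).
  have : semistd_fill P N.+1 s (nth 0 l) (extend N (nth 0 (rowseq m)) (entry U)).
    apply: semistd_fill_extend => //; first by rewrite -!sumn_nth.
    exact/(in_ssytP _ _ (ss m)).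
  by apply: eq_semistd_fill => // i j ji; rewrite extE.
apply/andP; split=> //; apply/eqP/ffunP => i; apply/val_inj; rewrite /= -!nth_rowseq.
have /andP[_ le1] := gh i; have /andP[_ le2] := cut_strip _ i extA.
(* Both row lengths count the columns of row [i] of [l] whose entry is below [N]. *)
have key j : j < nth 0 l i -> (j < nth 0 (rowseq (cut (ext U))) i) = (j < nth 0 (rowseq m) i).
  by move=> ji; rewrite -cutP // extE // extend_cut.
apply/eqP; rewrite eqn_leq; apply/andP; split; rewrite leqNgt; apply/negP => lt'.
  by move: (key _ (leq_trans lt' le2)); rewrite lt' ltnn.
by move: (key _ (leq_trans lt' le1)); rewrite lt' ltnn.
Qed.

(** An injective filling of |l| cells by |l| values is a bijection, so each value occurs exactly
    once; weak and strict increase along rows then coincide. *)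
Lemma nb_syt_count l : nb_syt l = ssyt_count (pred1 1) (sumn l) l.
Proof.
apply: eq_card => T; rewrite !inE; apply/andP/andP.
  move=> [/injectiveP T_inj /forallP h]; split.
    apply/forallP => c; apply/forallP => d; move/forallP: (h c) => /(_ d) /andP[h1 h2].
    by rewrite h2 andbT; apply/implyP => /(implyP h1)/ltnW.
  apply/forallP => v.
  have [c ->] : exists c, v = T c.
    by apply/codomP; apply: inj_card_onto => //; rewrite card_ord card_cell.
  suff -> : [set c' | T c' == T c] = [set c] by rewrite /= cards1.
  by apply/setP => d; rewrite !inE (inj_eq T_inj).
move=> [/forallP h /forallP h1].
have T_inj : injective T.
  move=> c d e; have /cards1P[b eb] := h1 (T c).
  have /set1P-> : c \in [set b] by rewrite -eb inE.
  by have /set1P-> : d \in [set b] by rewrite -eb inE e.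
split; first exact/injectiveP.
apply/forallP => c; apply/forallP => d; move/forallP: (h c) => /(_ d) /andP[h2 h3].
rewrite h3 andbT; apply/implyP => /andP[rcd ccd].
rewrite ltn_neqAle (implyP h2) ?rcd // andbT; apply/eqP => /val_inj/T_inj e.
by rewrite e ltnn in ccd.
Qed.

Lemma ssyt_count_empty P N l : (forall i, nth 0 l i = 0) ->
  ssyt_count P N l = [forall v : 'I_N, P 0].
Proof.
move=> l0; have nocell (c : cell l) : False.
  by have := cell_col_lt c; rewrite l0.
have one : #|{ffun cell l -> 'I_N}| = 1.
  by rewrite card_ffun (eq_card0 (A := cell l)).
have P0 (T : {ffun cell l -> 'I_N}) v : #|[set c | T c == v]| = 0.
  by apply/eqP; rewrite cards_eq0; apply/eqP/setP => c; case: (nocell c).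
rewrite /ssyt_count.
rewrite (@eq_card _ _ (fun _ : {ffun cell l -> 'I_N} => [forall v : 'I_N, P 0])).
  by case: [forall v : 'I_N, P 0]; [exact: one|rewrite eq_card0].
move=> T; rewrite inE [RHS]unfold_in.
have -> /= : is_ssyt T by apply/forallP => c; case: (nocell c).
by apply: eq_forallb => v; rewrite P0.
Qed.

(** The first column would contain N + 1 strictly increasing entries below N. *)
Lemma ssyt_count_too_long P N l :
  (forall i, nth 0 l i.+1 <= nth 0 l i) -> 0 < nth 0 l N -> ssyt_count P N l = 0.
Proof.
move=> l_noninc lN; apply: eq_card0 => T; rewrite inE; apply/negP.
move=> /andP[/is_ssytP[_ h] _].
have lpos i : i <= N -> 0 < nth 0 l i.
  elim: N lN {T h} => [|N IH] lN; first by rewrite leqn0 => /eqP->.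
  rewrite leq_eqVlt => /predU1P[->//|]; apply: IH.
  exact: leq_trans lN (l_noninc N).
have : forall i, i <= N -> i <= entry T i 0.
  elim=> // i IH iN; apply: leq_ltn_trans (IH (ltnW iN)) _.
  by apply: h => //; apply: lpos => //; apply: ltnW.
by move=> /(_ N (leqnn N)); rewrite leqNgt entry_lt.
Qed.

Local Open Scope ring_scope.

(** * The dimension determinant *)

Section Determinants.
Variable R : comNzRingType.

(** Multilinearity in the rows: [f] picks one summand in each row. *)
Lemma det_sum_rows (J : finType) n (Q : 'I_n -> pred J) (F : 'I_n -> J -> 'I_n -> R) :
  \det (\matrix_(i, j) \sum_(v | Q i v) F i v j)
  = \sum_(f in family Q) \det (\matrix_(i, j) F i (f i) j).
Proof.
rewrite /determinant [RHS]exchange_big; apply: eq_bigr => s _ /=.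
rewrite -big_distrr /=; congr (_ * _).
rewrite (eq_bigr (fun i => \sum_(v | Q i v) F i v (s i))).
  rewrite (bigA_distr_big_dep (fun i v => Q i v) (fun i v => F i v (s i))).
  by apply: eq_bigr => f _; apply: eq_bigr => i _; rewrite mxE.
by move=> i _; rewrite mxE.
Qed.

(** Subtracting from each row the next one is multiplication by a unitriangular [E]; the constant
    last column becomes a unit vector, along which the determinant is expanded. *)
Lemma det_row_differences n (A : 'M[R]_n.+1) : (forall i, A i ord_max = 1) ->
  \det A = \det (\matrix_(i < n, j < n)
    (A (lift ord_max i) (lift ord_max j) - A (lift ord0 i) (lift ord_max j))).
Proof.
move=> A1.
pose E : 'M[R]_n.+1 := \matrix_(i, j) ((j == i)%:R - ((j : nat) == i.+1)%:R).
have detE : \det E = 1.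
  rewrite -det_tr det_trig; last first.
    apply/is_trig_mxP => i j ij; rewrite !mxE.
    by rewrite -val_eqE /= !ltn_eqF // ?subrr // ltnW.
  by rewrite big1 // => i _; rewrite !mxE eqxx ltn_eqF // subr0.
have EA (i : 'I_n) j : (E *m A) (lift ord_max i) j = A (lift ord_max i) j - A (lift ord0 i) j.
  rewrite mxE (eq_bigr (fun k => (k == lift ord_max i)%:R * A k j
     - (k == lift ord0 i)%:R * A k j)).
    rewrite sumrB; congr (_ - _).
      rewrite (bigD1 (lift ord_max i)) //= eqxx mul1r big1 ?addr0 // => k /negbTE->.
      by rewrite mul0r.
    rewrite (bigD1 (lift ord0 i)) //= eqxx mul1r big1 ?addr0 // => k /negbTE->.
    by rewrite mul0r.
  move=> k _; rewrite mxE mulrBl; congr (_ - (_)%:R * _).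
  by rewrite -val_eqE /= /bump leqNgt ltn_ord add0n.
have EAmax j : (E *m A) ord_max j = A ord_max j.
  rewrite mxE (bigD1 ord_max) //= mxE eqxx ltn_eqF // subr0 mul1r big1 ?addr0 //.
  by move=> k kn; rewrite mxE (negbTE kn) ltn_eqF ?subrr ?mul0r.
rewrite -[LHS]mul1r -detE -det_mulmx (expand_det_col _ ord_max).
rewrite (bigD1 ord_max) //= EAmax A1 mul1r big1 ?addr0.
  rewrite /cofactor addnn -signr_odd odd_double mul1r; congr (\det _).
  by apply/matrixP => i j; rewrite [LHS]mxE [LHS]mxE EA mxE.
move=> i; case: (unliftP ord_max i) => [k ->|->]; last by rewrite eqxx.
by rewrite EA !A1 subrr mul0r.
Qed.

(** The product of the differences x_i - x_j, i < j, divided by 0! 1! ... (N-1)!, as in the Weyl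
    dimension formula; binomial entries avoid the division. *)
Definition weyl N (x : 'I_N -> nat) : R := \det (\matrix_(i, j) ('C(x i, N - j.+1))%:R).

Definition pos N (l : seq nat) (i : 'I_N) : nat := nth 0%N l i + (N - i.+1).

(** Pascal's rule makes the sum telescope. *)
Lemma sum_bin_column B a b c d : (a <= b.+1)%N -> (b <= B)%N ->
  \sum_(v : 'I_B.+1 | (a <= v <= b)%N) ('C(v + c, d))%:R
  = ('C(b.+1 + c, d.+1))%:R - ('C(a + c, d.+1))%:R :> R.
Proof.
move=> ab bB.
rewrite -(big_mkord (fun v => a <= v <= b)%N (fun v => ('C(v + c, d))%:R)).
rewrite -(@telescope_sumr _ a b.+1 (fun v => ('C(v + c, d.+1))%:R)) //.
rewrite (big_nat_widenl a 0) // (big_nat_widen 0 b.+1 B.+1) //.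
apply: eq_big => v; first by rewrite ltnS.
by move=> _; rewrite addSn binS natrD addrAC subrr add0r.
Qed.

(** Both sides obey the Gelfand-Tsetlin recursion: each row difference of the determinant is a sum
    over the interlacing interval of [m i], and multilinearity turns these into one sum over
    strips. *)
Lemma ssyt_count_weyl N l : (forall i, nth 0 l i.+1 <= nth 0 l i)%N ->
  nth 0%N l N = 0%N -> (ssyt_count xpredT N l)%:R = weyl (pos l : 'I_N -> nat).
Proof.
elim: N l => [|N IH] l l_noninc lN.
  rewrite ssyt_count_empty; last first.
    by elim=> // i e; have := l_noninc i; rewrite e leqn0 => /eqP.
  by rewrite /weyl det_mx00; rewrite (introT forallP).
rewrite (@ssyt_count_branch _ _ N (nth 0 l 0)%N) //; last 2 first.
- elim=> // i IHi; rewrite ltnS leq_eqVlt => /predU1P[<-//|/IHi e].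
  by have := l_noninc i; rewrite e leqn0 => /eqP.
- by right.
rewrite /weyl det_row_differences; last by move=> i; rewrite mxE /= subnn bin0.
have lB i : (nth 0 l i <= nth 0 l 0)%N.
  by elim: i => // i h; apply: leq_trans (l_noninc i) h.
pose Q (i : 'I_N) := [pred v : 'I_(nth 0%N l 0).+1 | nth 0 l i.+1 <= v <= nth 0 l i]%N.
rewrite natr_sum.
transitivity (\det (\matrix_(i < N, j < N)
    \sum_(v | Q i v) ('C(v + (N - i.+1), N - j.+1))%:R : 'M[R]_N)); last first.
  congr (\det _); apply/matrixP => i j; rewrite !mxE sum_bin_column //; last first.
    exact: leqW.
  rewrite /pos /= /bump leqNgt ltn_ord add0n leqNgt ltn_ord add0n /=.
  have iN := ltn_ord i; have jN := ltn_ord j.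
  congr ('C(_, _)%:R - 'C(_, _)%:R); lia.
rewrite det_sum_rows; apply: eq_big => [m|m]; rewrite andbT.
  by apply/forallP/familyP.
move=> /forallP ml.
rewrite IH; last 2 first.
- move=> i; case: (ltnP i.+1 N) => iN; last by rewrite nth_rowseq_default.
  rewrite (nth_rowseq m (Ordinal iN)) (nth_rowseq m (Ordinal (ltnW iN))).
  case/andP: (ml (Ordinal iN)) => _ h1; case/andP: (ml (Ordinal (ltnW iN))) => h2 _.
  exact: leq_trans h1 h2.
- exact: nth_rowseq_default.
congr (\det _); apply/matrixP => i j; rewrite !mxE /pos nth_rowseq //.
Qed.

End Determinants.

(** * The functions psi *)

Lemma ffact_succ n m : (n.+1 ^_ m = n ^_ m + m * n ^_ m.-1)%N.
Proof.
case: m => [|m]; first by rewrite !ffactn0.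
rewrite ffactSS ffactnSr /=; case: (leqP m n) => h; last by rewrite ffact_small ?muln0.
by rewrite mulnC [(m.+1 * _)%N]mulnC -mulnDr; congr (_ * _)%N; lia.
Qed.

(** Multiplied by a!, both sides equal [(m + z) ^_ (a + m)]. *)
Lemma ffact_bin m z a : ('C(m + z, a + m) * (a + m) ^_ m = (m + z) ^_ m * 'C(z, a))%N.
Proof.
apply/eqP; rewrite -(eqn_pmul2r (fact_gt0 a)) -!mulnA bin_ffact; apply/eqP.
have -> : ((a + m) ^_ m * a`! = (a + m)`!)%N by rewrite -[in a`!](addnK m a) ffact_fact ?leq_addl.
rewrite bin_ffact [(m + z)%N]addnC.
elim: m => [|m IH]; first by rewrite !addn0 ffactn0 mul1n.
by rewrite !addnS !ffactSS IH mulnA.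
Qed.

(** This expansion in the binomials C(y, s) supplies the matrix Z. For y = m + z, the term s = m + a
    carries the factor [y ^_ m] by [ffact_bin], and Vandermonde's convolution sums the rest. *)
Lemma ffact_mul_bin y p m j :
  (y ^_ m * 'C(y + p, j) =
   \sum_(0 <= s < (j + m).+1) 'C(y, s) * s ^_ m * 'C(m + p, j + m - s))%N.
Proof.
case: (ltnP y m) => [ym|my].
  rewrite ffact_small // mul0n big1_seq // => s _.
  case: (ltnP y s) => ys; first by rewrite bin_small.
  by rewrite [(s ^_ m)%N]ffact_small ?muln0 // (leq_ltn_trans ys).
rewrite -(subnKC my); set z := (y - m)%N.
rewrite (big_cat_nat (n := m)) //=; last by rewrite leqW // leq_addl.
rewrite big1_seq ?add0n; last first.
  move=> s; rewrite mem_index_iota => /andP[_ /andP[_ sm]].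
  by rewrite [(s ^_ m)%N]ffact_small ?muln0.
rewrite -[X in index_iota X]add0n big_addn subSn ?leq_addl // addnK big_mkord.
rewrite [(m + z + p)%N]addnAC [(m + p + z)%N]addnC -(binomial.Vandermonde z) big_distrr /=.
by apply: eq_bigr => a _; rewrite ffact_bin mulnA subnDr.
Qed.

Section Alternating.
Variable R : comNzRingType.
Variable N : nat.
Implicit Types (x : 'I_N -> nat) (i j : 'I_N).

Definition bump_at x i p : 'I_N -> nat := fun j => (x j + p * (j == i))%N.

Definition psi m p x : R := \sum_i (x i ^_ m)%:R * weyl R (bump_at x i p).

Lemma eq_weyl x y : x =1 y -> weyl R x = weyl R y.
Proof. by move=> e; congr (\det _); apply/matrixP => i j; rewrite !mxE e. Qed.

Lemma eq_psi m p x y : x =1 y -> psi m p x = psi m p y.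
Proof.
move=> e; apply: eq_bigr => i _; rewrite e; congr (_ * _).
by apply: eq_weyl => j; rewrite /bump_at e.
Qed.

Lemma weyl_repeat x i j : i != j -> x i = x j -> weyl R x = 0.
Proof.
by move=> ij e; apply: (determinant_alternate ij) => k; rewrite !mxE e.
Qed.

Lemma weyl_tperm x i j : i != j -> weyl R (x \o tperm i j) = - weyl R x.
Proof.
move=> ij; rewrite /weyl -[RHS]mulN1r.
have -> : -1 = \det (perm_mx (tperm i j)) :> R by rewrite det_perm odd_tperm ij expr1.
rewrite -det_mulmx -row_permE; congr (\det _).
by apply/matrixP => a b; rewrite !mxE.
Qed.

(** Summands other than [i] and [j] still have a repeated coordinate; those two differ by a
    transposition and cancel. *)
Lemma psi_repeat m p x i j : i != j -> x i = x j -> psi m p x = 0.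
Proof.
move=> ij e; rewrite /psi (bigD1 i) //= (bigD1 j) 1?eq_sym //= [X in _ + (_ + X)]big1.
  rewrite addr0 -e -mulrDr [weyl R (bump_at x j p)](eq_weyl (y := bump_at x i p \o tperm i j)).
    by rewrite weyl_tperm // subrr mulr0.
  move=> k; rewrite /bump_at /=; case: tpermP => [->|->|/eqP ki /eqP kj].
  - by rewrite e [j == i]eq_sym.
  - by rewrite !eqxx e.
  - by rewrite (negbTE ki) (negbTE kj).
move=> k /andP[ki kj]; rewrite [weyl R _](weyl_repeat ij) ?mulr0 //.
by rewrite /bump_at e ![_ == k]eq_sym (negbTE ki) (negbTE kj).
Qed.

(** Only row [i] changes, so the cofactors along it are those of the unbumped matrix. *)
Lemma weyl_bump x i p : weyl R (bump_at x i p) =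
  \sum_(j < N) ('C(x i + p, N - j.+1))%:R
    * cofactor (\matrix_(i, j) ('C(x i, N - j.+1))%:R) i j.
Proof.
rewrite /weyl (expand_det_row _ i); apply: eq_bigr => j _.
rewrite mxE /bump_at eqxx muln1; congr (_ * (_ * \det _)).
apply/matrixP => a b; rewrite !mxE [lift i a == i]eq_sym.
by rewrite (negbTE (neq_lift _ _)) muln0 addn0.
Qed.

(* Cofactor expansion along the bumped rows turns the sum over i into
   tr (M Z adj M) = tr Z det M. *)
Lemma psi_eigen m p x : m = 0%N \/ (forall i, x i < N)%N ->
  psi m p x = (\sum_(0 <= s < N) s ^_ m * 'C(m + p, m))%:R * weyl R x.
Proof.
move=> hx; pose M : 'M[R]_N := \matrix_(i, j) ('C(x i, N - j.+1))%:R.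
(* The guard matters: with truncated subtraction alone, the entries with r > J + m would be [r ^_ m]
   instead of 0. *)
pose z r J : R := if (r <= J + m)%N then (r ^_ m * 'C(m + p, J + m - r))%:R else 0.
pose Z : 'M[R]_N := \matrix_(i, j) z (N - i.+1)%N (N - j.+1)%N.
have MZ i j : (M *m Z) i j = (x i ^_ m)%:R * ('C(x i + p, N - j.+1))%:R.
  have jN : (N - j.+1 < N)%N by have := ltn_ord j; lia.
  rewrite -natrM ffact_mul_bin natr_sum mxE.
  transitivity (\sum_(s < N) ('C(x i, s))%:R * z s (N - j.+1)%N).
    by rewrite [RHS](reindex_inj rev_ord_inj); apply: eq_bigr => s _; rewrite !mxE.
  set J := (N - j.+1)%N in jN *.
  rewrite -(big_mkord xpredT (fun s => ('C(x i, s))%:R * z s J)).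
  case: (leqP (J + m).+1 N) => JN.
    rewrite [RHS](big_nat_widen 0 (J + m).+1 N) // [RHS]big_mkcond; apply: eq_bigr => s _ /=.
    by rewrite /z ltnS; case: (s <= J + m)%N; rewrite ?mulr0 // -mulnA [RHS]natrM.
  (* The expansion reaches past the N columns of [M]. The extra terms have s >= N and vanish when
     x_i < N; for m = 0 this case cannot occur. *)
  rewrite [RHS](big_cat_nat (n := N)) //=; last exact: ltnW.
  rewrite [X in _ = _ + X]big1_seq ?addr0.
    apply: eq_big_nat => s /andP[_ sN]; rewrite /z -mulnA [RHS]natrM.
    by rewrite (leq_trans (ltnW sN) JN).
  move=> s; rewrite mem_index_iota => /and3P[_ Ns _].
  case: hx => [m0|/(_ i) xN]; first by move: JN; rewrite m0 addn0 ltnNge jN.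
  by rewrite bin_small ?mul0n // (leq_trans xN).
have -> : psi m p x = \tr (M *m Z *m \adj M).
  apply: eq_bigr => i _; rewrite weyl_bump mxE big_distrr; apply: eq_bigr => j _ /=.
  by rewrite MZ mulrA [in RHS]mxE.
rewrite -mulmxA mxtrace_mulC -mulmxA mul_adj_mx mul_mx_scalar mxtraceZ mulrC.
congr (_ * _); rewrite natr_sum big_mkord /mxtrace.
rewrite [RHS](reindex_inj rev_ord_inj) /=; apply: eq_bigr => i _.
by rewrite mxE /z leq_addr addKn.
Qed.

(** Pieri's rule at the level of dimensions: for m = 0 and p = 1 the factor in [psi_eigen] is a sum
    of N ones. *)
Lemma weyl_pieri x : \sum_i weyl R (bump_at x i 1) = N%:R * weyl R x.
Proof.
transitivity (psi 0 1 x); first by apply: eq_bigr => i _; rewrite ffactn0 mul1r.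
rewrite psi_eigen; last by left.
by congr (_%:R * _); rewrite (eq_bigr (fun=> 1%N)) // sum_nat_const_nat subn0 muln1.
Qed.

Lemma bump_atC x i j p q : bump_at (bump_at x i p) j q =1 bump_at (bump_at x j q) i p.
Proof. by move=> k; rewrite /bump_at addnAC. Qed.

(** Apply [weyl_pieri] at the point already bumped by [p]. A further bump at j != i leaves x_i
    alone; at j = i, [ffact_succ] produces the extra term, with bump p + 1. *)
Lemma psi_step m p x :
  \sum_i psi m p (bump_at x i 1) = N%:R * psi m p x + m%:R * psi m.-1 p.+1 x.
Proof.
rewrite /psi exchange_big /= !big_distrr -big_split /=; apply: eq_bigr => i _.
rewrite mulrCA -weyl_pieri.
rewrite big_distrr /=.
rewrite (bigD1 i) //= [X in _ = X + _](bigD1 i) //= addrAC; congr (_ + _).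
  rewrite {1}/bump_at eqxx (eq_weyl (bump_atC _ _ _ _ _)).
  rewrite mulrA -natrM [weyl R (bump_at x i p.+1)](eq_weyl (y := bump_at (bump_at x i p) i 1)).
    rewrite -mulrDl -natrD; congr (_%:R * _).
    by rewrite muln1 addn1 ffact_succ.
  by move=> k; rewrite /bump_at -addnA -mulnDl addn1.
apply: eq_bigr => j ji; rewrite {1}/bump_at eq_sym (negbTE ji) muln0 addn0.
by rewrite (eq_weyl (bump_atC _ _ _ _ _)).
Qed.

End Alternating.

(** * Summation over partitions of fixed weight *)

Lemma sum_ffact n m : (m.+1 * \sum_(0 <= s < n) s ^_ m = n ^_ m.+1)%N.
Proof.
elim: n => [|n IH]; first by rewrite big_geq // muln0.
by rewrite big_nat_recr //= mulnDr IH ffact_succ.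
Qed.

Lemma sorted_geq_nth l :
  reflect (forall i, nth 0 l i.+1 <= nth 0 l i)%N (sorted geq l).
Proof.
apply: (iffP (sortedP 0)) => h i; last by move=> _; apply: h.
by case: (ltnP i.+1 (size l)) => [/h//|ge]; rewrite nth_default.
Qed.

Section Walk.
Variable R : comNzRingType.
Variables N B : nat.
Implicit Types (x : 'I_N.+1 -> nat) (m u : {ffun 'I_N.+1 -> 'I_B.+1}).

Definition is_shape (n : nat) m : bool :=
  sorted geq (rowseq m) && (sumn (rowseq m) == n).

(** A_n(phi) of the overview, for N + 1 rows. Parts of a partition of n are at most n, so no shape
    is lost once [n <= B]. *)
Definition walk (n : nat) (phi : ('I_N.+1 -> nat) -> R) : R :=
  \sum_(m | is_shape n m)
    (ssyt_count (pred1 1%N) n (rowseq m))%:R * phi (pos (rowseq m)).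

Lemma is_shape_le n m i : is_shape n m -> (m i <= n)%N.
Proof.
by move=> /andP[_ /eqP<-]; rewrite sumn_rowseq (bigD1 i) //= leq_addr.
Qed.

Definition add_box u (i : 'I_N.+1) : {ffun 'I_N.+1 -> 'I_B.+1} :=
  [ffun j => inord (u j + (j == i))].

Lemma add_boxE n u i j : (n < B)%N -> is_shape n u ->
  add_box u i j = (u j + (j == i))%N :> nat.
Proof.
move=> nB /(is_shape_le j) uj; rewrite ffunE inordK // ltnS.
by case: (_ == _); lia.
Qed.

(** No row of [u] is longer than that of [m] and the weights differ by one, so a single row grows,
    by one box. *)
Lemma strip_uniq n u m : is_shape n u -> is_shape n.+1 m -> strip (rowseq m) u ->
  exists i, forall j, m j = (u j + (j == i))%N :> nat.
Proof.
move=> /andP[_ /eqP us] /andP[_ /eqP ms] /forallP st.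
rewrite !sumn_rowseq in us ms.
have le j : (u j <= m j)%N by have /andP[_] := st j; rewrite nth_rowseq.
have [i hi] : exists i, (u i < m i)%N.
  apply/existsP; rewrite -[[exists _, _]]negbK negb_exists; apply/negP => /forallP h.
  have : (n.+1 <= n)%N; last by rewrite ltnn.
  by rewrite -ms -us leq_sum // => j _; rewrite leqNgt h.
rewrite (bigD1 i) //= in ms; rewrite (bigD1 i) //= in us.
have one a b c d : (a + c = n.+1 -> b + d = n -> d <= c -> b < a -> a = b + 1)%N by lia.
have other a b c d a' b' : (a + (a' + c) = n.+1 -> b + (b' + d) = n ->
    d <= c -> b < a -> b' <= a' -> a' = b' + 0)%N by lia.
exists i => j; case: (eqVneq j i) => [->|ji].
  by apply: one ms us _ hi; apply: leq_sum.
rewrite (bigD1 j) //= in ms; rewrite (bigD1 j) //= in us.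
by apply: other ms us _ hi (le j); apply: leq_sum.
Qed.

(** Interlacing already makes [u] weakly decreasing, so only its weight is left to check; this
    matches the condition that the largest entry occurs once. *)
Lemma strip_shape n u m : is_shape n.+1 m -> strip (rowseq m) u ->
  is_shape n u = (pred1 1%N (sumn (rowseq m) - sumn (rowseq u))%N).
Proof.
move=> /andP[_ /eqP ms] /forallP st; rewrite /is_shape ms.
have -> : sorted geq (rowseq u).
  apply/sorted_geq_nth => i.
  case: (ltnP i.+1 N.+1) => iN; last by rewrite nth_rowseq_default.
  have /andP[_ h1] := st (Ordinal iN); have /andP[h2 _] := st (Ordinal (ltnW iN)).
  rewrite (nth_rowseq u (Ordinal iN)) (nth_rowseq u (Ordinal (ltnW iN))).
  exact: leq_trans h1 h2.
have : (sumn (rowseq u) <= n.+1)%N.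
  rewrite -ms !sumn_rowseq leq_sum // => i _.
  by have /andP[_] := st i; rewrite nth_rowseq.
by move=> h; apply/eqP/eqP; lia.
Qed.

Variable phi : ('I_N.+1 -> nat) -> R.
Hypothesis phi_ext : forall x y, x =1 y -> phi x = phi y.
Hypothesis phi_repeat : forall x i j, i != j -> x i = x j -> phi x = 0.

(** A box that does not yield a partition is added to a row as long as the one above it; two
    coordinates then coincide and [phi] vanishes. *)
Lemma sum_strip n u : (n < B)%N -> is_shape n u ->
  \sum_(m | is_shape n.+1 m && strip (rowseq m) u) phi (pos (rowseq m))
  = \sum_i phi (bump_at (pos (rowseq u)) i 1).
Proof.
move=> nB hu; have aE := add_boxE _ _ nB hu.
(* The row in which [m] is longer than [u] recovers the added box. *)
pose h' m := odflt ord0 [pick i | (u i < m i)%N].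
rewrite (reindex_onto (add_box u) h') /=; last first.
  move=> m /andP[hm st]; have [i mi] := strip_uniq hu hm st.
  rewrite /h'; case: pickP => [k|/(_ i)]; last by rewrite mi eqxx addn1 ltnSn.
  rewrite mi; case: eqVneq => [-> _|_]; last by rewrite addn0 ltnn.
  by apply/ffunP => j; apply/val_inj; rewrite /= aE mi.
rewrite big_mkcond /=; apply: eq_bigr => i _.
have -> : (h' (add_box u i) == i).
  rewrite /h'; case: pickP => [k|/(_ i)]; last by rewrite aE eqxx addn1 ltnSn.
  by rewrite aE; case: eqVneq => // _; rewrite addn0 ltnn.
rewrite andbT.
have e : pos (rowseq (add_box u i)) =1 bump_at (pos (rowseq u)) i 1.
  by move=> j; rewrite /bump_at /pos !nth_rowseq aE mul1n addnAC.
rewrite (phi_ext e); case: ifP => // /negbT noP; symmetry.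
have u_noninc : forall k, (nth 0 (rowseq u) k.+1 <= nth 0 (rowseq u) k)%N.
  by apply/sorted_geq_nth; case/andP: hu.
have /existsP[k /andP[ki /eqP uk]] : [exists k : 'I_N.+1, (k.+1 == i :> nat) && (u k == u i)].
  apply: contraNT noP; rewrite negb_exists => /forallP nok.
  have st k : (nth 0 (rowseq (add_box u i)) k.+1 <= nth 0 (rowseq u) k)%N.
    case: (ltnP k.+1 N.+1) => kN; last by rewrite nth_rowseq_default.
    rewrite (nth_rowseq (add_box u i) (Ordinal kN)) aE -(nth_rowseq u) /=.
    have := u_noninc k; have := nok (Ordinal (ltnW kN)).
    rewrite -[_ == i](inj_eq val_inj) /= -val_eqE /=.
    rewrite -(nth_rowseq u (Ordinal (ltnW kN))) /=.
    case: (eqVneq k.+1 (i : nat)) => [ki|_] /=; last by rewrite addn0.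
    rewrite -nth_rowseq -ki; lia.
  have st2 : strip (rowseq (add_box u i)) u.
    by apply/forallP => k; rewrite -(nth_rowseq u k) st /= !nth_rowseq aE leq_addr.
  rewrite st2 andbT /is_shape; apply/andP; split.
    apply/sorted_geq_nth => k; apply: leq_trans (st k) _.
    case: (ltnP k N.+1) => kN; last by rewrite nth_rowseq_default.
    by rewrite !(nth_rowseq _ (Ordinal kN)) aE leq_addr.
  rewrite sumn_rowseq (eq_bigr (fun j => u j + (j == i))%N) => [|j _]; last exact: aE.
  rewrite big_split /= -sumn_rowseq; case/andP: hu => _ /eqP->.
  by rewrite (bigD1 i) //= eqxx big1 ?addn0 ?addn1 // => j /negbTE->.
have ik : i != k by rewrite -val_eqE /= -(eqP ki) gtn_eqF.
apply: (phi_repeat ik).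
rewrite /bump_at /pos !nth_rowseq eqxx (negbTE (_ : k != i)) 1?eq_sym // uk.
by have := ltn_ord i; have := eqP ki; lia.
Qed.

(** The cell of the largest entry is removed, and the sums are exchanged so that [sum_strip] applies
    to each smaller shape. *)
Lemma walk_step n : (n < B)%N ->
  walk n.+1 phi = walk n (fun x => \sum_i phi (bump_at x i 1)).
Proof.
move=> nB; rewrite /walk.
transitivity (\sum_(m | is_shape n.+1 m) \sum_(u | is_shape n u && strip (rowseq m) u)
    (ssyt_count (pred1 1%N) n (rowseq u))%:R * phi (pos (rowseq m))).
  apply: eq_bigr => m hm; rewrite -big_distrl /=; congr (_ * _).
  rewrite (@ssyt_count_branch _ _ N.+1 B).
  - rewrite natr_sum; apply: eq_bigl => u.
    by case st : (strip _ u); rewrite ?andbF // andbT (strip_shape hm st).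
  - by apply/sorted_geq_nth; case/andP: hm.
  - by move=> i iN; rewrite nth_rowseq_default // ltnW.
  - by left; rewrite nth_rowseq_default.
  - by rewrite (nth_rowseq m ord0) -ltnS ltn_ord.
rewrite (exchange_big_dep (is_shape n)) /=; last by move=> m u _ /andP[].
apply: eq_bigr => u hu; rewrite -(sum_strip nB hu) big_distrr /=.
by apply: eq_bigl => m; rewrite hu.
Qed.

Lemma walk0 : walk 0 phi = phi (pos [::]).
Proof.
pose z : {ffun 'I_N.+1 -> 'I_B.+1} := [ffun=> ord0].
have z0 i : nth 0%N (rowseq z) i = 0%N.
  case: (ltnP i N.+1) => iN; last by rewrite nth_rowseq_default.
  by rewrite (nth_rowseq z (Ordinal iN)) ffunE.
rewrite /walk (big_pred1 z) => [|m].
  rewrite ssyt_count_empty // (introT forallP) ?mul1r; last by case.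
  by apply: phi_ext => i; rewrite /pos z0 nth_nil.
apply/idP/eqP => [hm|->].
  by apply/ffunP => i; apply/val_inj; rewrite ffunE /=; have := is_shape_le i hm; lia.
rewrite /is_shape sumn_rowseq big1 ?eqxx ?andbT => [|i _]; last by rewrite ffunE.
by apply/sorted_geq_nth => i; rewrite !z0.
Qed.

End Walk.

(** * Iterated steps on psi and its value at the staircase *)

Section WalkPsi.
Variable R : comNzRingType.
Variables N B : nat.

(** Among n applications of [psi_step], r lower the index m, chosen in C(n, r) ways with total
    factor [m ^_ r]; each of the others contributes N + 1. *)
Lemma walk_psi n m p : (n <= B)%N ->
  walk B n (@psi R N.+1 m p) =
  \sum_(0 <= r < m.+1) ('C(n, r) * m ^_ r * N.+1 ^ (n - r))%:R
    * psi R (m - r) (p + r) (pos [::] : 'I_N.+1 -> nat).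
Proof.
have step k q j : (j < B)%N -> walk B j.+1 (@psi R N.+1 k q) =
    N.+1%:R * walk B j (@psi R N.+1 k q) + k%:R * walk B j (@psi R N.+1 k.-1 q.+1).
  move=> jB; rewrite (walk_step (@eq_psi R N.+1 k q) (@psi_repeat R N.+1 k q)) //.
  rewrite /walk !big_distrr -big_split /=; apply: eq_bigr => u _.
  by rewrite psi_step mulrDr; congr (_ + _); rewrite mulrCA.
elim: n m p => [|n IH] m p nB.
  rewrite (walk0 _ (@eq_psi R N.+1 m p)) big_nat_recl // big1 => [|r _].
    by rewrite bin0 ffactn0 subnn expn0 !mul1r subn0 !addn0 addr0.
  by rewrite bin0n !mul0n mul0r.
rewrite step // !IH ?(ltnW nB) //.
case: m => [|m].
  rewrite mul0r addr0 !big_nat1 !bin0 !ffactn0 !subn0 mulrA -natrM.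
  by rewrite !mul1n expnS.
rewrite big_nat_recl // [RHS]big_nat_recl // mulrDr -addrA; congr (_ + _).
  by rewrite !bin0 !ffactn0 !subn0 mulrA -natrM !mul1n expnS.
rewrite !big_distrr -big_split /=; apply: eq_bigr => r _.
rewrite !subSS addSnnS !mulrA -!natrM -mulrDl -natrD; congr (_%:R * _).
rewrite binS !mulnDl ffactSS; congr addn; last first.
  by rewrite !mulnA [(m.+1 * _)%N]mulnC.
(* For r >= n the exponent is truncated, but C(n, r + 1) is zero. *)
case: (ltnP r n) => rn; last by rewrite bin_small ?mul0n ?muln0.
by rewrite mulnCA -expnS subnSK.
Qed.

(** The staircase coordinates are below N, so [psi_eigen] applies, and their binomial matrix is
    unitriangular. *)
Lemma psi_staircase m p : psi R m p (pos [::] : 'I_N -> nat) =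
  (\sum_(0 <= s < N) s ^_ m * 'C(m + p, m))%:R.
Proof.
rewrite psi_eigen; last first.
  by right=> i; rewrite /pos nth_nil add0n; have := ltn_ord i; lia.
rewrite [weyl _ _](_ : _ = 1) ?mulr1 // /weyl -det_tr det_trig.
  by rewrite big1 // => i _; rewrite !mxE /pos nth_nil add0n binn.
apply/is_trig_mxP => i j ij; rewrite !mxE /pos nth_nil add0n bin_small //.
by have := ltn_ord j; lia.
Qed.

End WalkPsi.

(** * Infinite sums *)

Lemma schur1E (R : comNzRingType) N l : schur1 R N l = (ssyt_count xpredT N l)%:R.
Proof.
rewrite /schur1 /schur rmorph_sum /= (eq_bigr (fun=> 1)) => [|T _]; last first.
  by rewrite rmorph_prod big1 //= => c _; rewrite mevalXU.
rewrite sumr_const; congr (_%:R); apply: eq_card => T.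
by rewrite inE [RHS]andbC /= (introT forallP).
Qed.

Lemma sorted_geq_trim s : sorted geq s ->
  exists k, s = [seq v <- s | v != 0%N] ++ nseq k 0%N.
Proof.
elim: s => [|a s IH] /=; first by exists 0%N.
move=> as_; have [k sk] := IH (path_sorted as_).
case: (eqVneq a 0%N) => [a0|_] /=; last by exists k; rewrite -sk.
exists (size s).+1; rewrite a0 in as_ *.
have s0 : s = nseq (size s) 0%N.
  apply/all_pred1P/allP => v vs /=; rewrite -leqn0.
  by have /allP/(_ _ vs) := order_path_min (rev_trans leq_trans) as_.
by rewrite {2}s0 filter_nseq /= -s0.
Qed.

Definition trim_zeros (s : seq nat) : seq nat := [seq v <- s | v != 0%N].

Lemma nth_trim s : sorted geq s -> nth 0%N (trim_zeros s) =1 nth 0%N s.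
Proof.
move=> /sorted_geq_trim[k sk] i; rewrite {2}sk nth_cat nth_nseq if_same.
by case: ltnP => // h; rewrite nth_default.
Qed.

Lemma sumn_trim s : sumn (trim_zeros s) = sumn s.
Proof. by elim: s => //= -[|a] s /= ->. Qed.

Lemma trim_is_part s : sorted geq s -> is_part (trim_zeros s).
Proof.
move=> hs; rewrite /is_part sorted_filter //; last exact: (rev_trans leq_trans).
by rewrite mem_filter eqxx.
Qed.

Section Series.
Variable R : realType.
Local Open Scope classical_set_scope.

Lemma esum_fintype (T : finType) (P : pred T) (a : T -> \bar R) :
  (forall x, 0 <= a x)%E ->
  (\esum_(i in [set x | P x]) a i = \sum_(i | P i) a i)%E.
Proof.
move=> a0; rewrite esum_fset; [|exact: finite_finset|by move=> x _].
rewrite -[RHS]big_filter [RHS]fsbig_seq ?filter_uniq ?index_enum_uniq //.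
by apply: eq_fsbigl; apply/seteqP; split=> x /=; rewrite mem_filter mem_index_enum andbT.
Qed.

(* A partition of n with at most N + 1 parts is encoded by its parts, padded by
   zeros, as a finite function m with [is_shape n m]. *)
Lemma esum_partitions N (F : seq nat -> \bar R) : (forall l, 0 <= F l)%E ->
  (forall l, is_part l -> (N.+1 < size l)%N -> F l = 0%E) ->
  (\esum_(l in [set l | is_part l]) F l =
   \sum_(n <oo) \sum_(m : {ffun 'I_N.+1 -> 'I_n.+1} | is_shape n m)
      F (trim_zeros (rowseq m)))%E.
Proof.
move=> F0 Flong.
pose J n := [set l | is_part l /\ sumn l = n].
have -> : [set l | is_part l] = \bigcup_(n in setT) J n.
  by apply/seteqP; split => [l pl|l [n _ []//]]; exists (sumn l).
rewrite esum_bigcupT //; last first.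
  apply/trivIsetP => i j _ _ ij; apply/seteqP; split=> // l [[_ e1] [_ e2]].
  by move: ij; rewrite -e1 -e2 eqxx.
rewrite nneseries_esumT; last by move=> n; apply: sume_ge0.
apply: eq_esum => n _.
pose short := [set l : seq nat | (size l <= N.+1)%N].
rewrite (esumID short) // [X in (_ + X)%E]esum1 ?adde0; last first.
  by move=> l [[pl _] /negP]; rewrite -ltnNge; apply: Flong.
rewrite -esum_fintype //.
apply: (reindex_esum [set m : {ffun 'I_N.+1 -> 'I_n.+1} | is_shape n m] _
  (fun m => trim_zeros (rowseq m))); split.
- move=> m /= /andP[hs /eqP ms]; split; first by split; [exact: trim_is_part|rewrite sumn_trim].
  by rewrite /short /= size_filter (leq_trans (count_size _ _)) // size_rowseq.
- move=> m m' /set_mem /andP[hs _] /set_mem /andP[hs' _] e.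
  apply/ffunP => i; apply/val_inj; rewrite /=.
  by rewrite -(nth_rowseq m) -(nth_rowseq m') -(nth_trim hs) -(nth_trim hs') e.
- move=> l [[/andP[sl l0] ln] lN] /=.
  have ll i : (nth 0 l i < n.+1)%N.
    rewrite ltnS -ln; case: (ltnP i (size l)) => il; last by rewrite nth_default.
    by rewrite sumnE (big_rem (nth 0%N l i)) ?mem_nth //= leq_addr.
  pose m : {ffun 'I_N.+1 -> 'I_n.+1} := [ffun i : 'I_N.+1 => Ordinal (ll i)].
  have rm : rowseq m = l ++ nseq (N.+1 - size l) 0%N.
    apply: (@eq_from_nth _ 0%N) => [|i].
      by rewrite size_rowseq size_cat size_nseq subnKC.
    rewrite size_rowseq => iN; rewrite (nth_rowseq m (Ordinal iN)) ffunE /=.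
    rewrite nth_cat nth_nseq if_same; case: ltnP => // h; rewrite nth_default //.
  have tm : trim_zeros (rowseq m) = l.
    rewrite /trim_zeros rm filter_cat filter_nseq cats0.
    by apply/all_filterP/allP => v vl; apply: contraNneq l0 => <-.
  exists m => //; apply/andP; split; last by rewrite -sumn_trim tm ln.
  apply/sorted_geq_nth => i; have := (elimT (sorted_geq_nth l) sl) i.
  rewrite rm !nth_cat !nth_nseq !if_same.
  case: (ltnP i.+1 (size l)) => h //; rewrite (ltnW h) //.
Qed.

(** Terms with n < r vanish, and otherwise [n ^_ r] / n! = 1/(n-r)!, so a shift of the index leaves
    the exponential series. *)
Lemma exp_series_ffact (x : R) r : 0 <= x ->
  (\sum_(n <oo) (x ^+ n / n`!%:R * (n ^_ r)%:R)%:E = (x ^+ r * expR x)%:E)%E.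
Proof.
move=> x0.
have f0 n q : (0 <= (x ^+ n / n`!%:R * (n ^_ q)%:R)%:E)%E.
  by rewrite lee_fin mulr_ge0 // divr_ge0 // exprn_ge0.
rewrite (nneseries_split 0 r) // add0n big_nat big1 ?add0e; last first.
  by move=> n /andP[_ nr]; rewrite ffact_small // mulr0.
rewrite -nneseries_addn //.
rewrite (eq_eseriesr (g := fun n => ((x ^+ r)%:E * (exp_coeff x n)%:E)%E)); last first.
  move=> n _; rewrite -EFinM exp_coeffE; congr EFin.
  have := ffact_fact (leq_addl n r); rewrite addnK => <-; rewrite natrM.
  have : ((n + r) ^_ r)%:R != 0 :> R by rewrite pnatr_eq0 -lt0n ffact_gt0 leq_addl.
  have : n`!%:R != 0 :> R by rewrite pnatr_eq0 -lt0n fact_gt0.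
  move: (n`!%:R) (((n + r) ^_ r)%:R) => f g f0' g0'.
  by rewrite exprD; field; rewrite f0' g0'.
rewrite nneseriesZl; last first.
  by move=> n _; rewrite lee_fin exp_coeff_ge0.
rewrite EFinM; congr (_ * _)%E.
rewrite /expR -EFin_lim; last exact: is_cvg_series_exp_coeff.
by apply/congr_lim/funext => n; rewrite /= /series /= sumEFin.
Qed.

Lemma exp_series_sum (x : R) K (c : nat -> R) : 0 <= x -> (forall r, 0 <= c r) ->
  (\sum_(n <oo) (\sum_(0 <= r < K) c r * (x ^+ n / n`!%:R * (n ^_ r)%:R))%:E
   = ((\sum_(0 <= r < K) c r * x ^+ r) * expR x)%:E)%E.
Proof.
move=> x0 c0.
rewrite (eq_eseriesr (g := fun n => (\sum_(0 <= r < K)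
   ((c r)%:E * (x ^+ n / n`!%:R * (n ^_ r)%:R)%:E))%E)); last first.
  by move=> n _; rewrite -sumEFin; apply: eq_bigr => r _; rewrite EFinM.
have f0 n q : (0 <= (x ^+ n / n`!%:R * (n ^_ q)%:R)%:E)%E.
  by rewrite lee_fin mulr_ge0 // divr_ge0 // exprn_ge0.
rewrite nneseries_sum_nat; last by move=> r n; rewrite mule_ge0 // lee_fin.
rewrite big_distrl /= -sumEFin; apply: eq_bigr => r _.
by rewrite nneseriesZl // exp_series_ffact // -EFinM mulrA.
Qed.

End Series.

(** * The terminating hypergeometric series *)

Section Hypergeometric.
Variable R : realType.

Lemma rising_opp_nat k i : rising (- k%:R : R) i = (-1) ^+ i * (k ^_ i)%:R.
Proof.
elim: i => [|i IH]; first by rewrite /rising big_ord0 expr0 mul1r.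
rewrite {1}/rising big_ord_recr -/(rising _ _) /= IH ffactnSr natrM exprS.
case: (leqP i k) => ik; first by rewrite natrB //; ring.
by rewrite ffact_small // !mul0r !mulr0 !mul0r.
Qed.

Lemma rising_2 i : rising (2 : R) i = (i.+1)`!%:R.
Proof.
elim: i => [|i IH]; first by rewrite /rising big_ord0.
by rewrite {1}/rising big_ord_recr -/(rising _ _) /= IH [in RHS]factS natrM mulrC -natrD.
Qed.

(** The two signs cancel and the factorials combine to C(k, i)^2 / (i + 1). Terms with i > k vanish,
    so the partial sums are eventually constant. *)
Lemma hyp2F1_opp_nat k (t : R) : hyp2F1 (- k%:R) (- k%:R) 2 t
  = \sum_(0 <= i < k.+1) ('C(k, i) ^ 2)%:R * t ^+ i / i.+1%:R.
Proof.
pose f i := rising (- k%:R) i * rising (- k%:R) i / rising 2 i * (t ^+ i / i`!%:R) : R.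
have fE i : f i = ('C(k, i) ^ 2)%:R * t ^+ i / i.+1%:R.
  have s2 : (-1) ^+ i * (-1) ^+ i = 1 :> R by rewrite -expr2 sqrr_sign.
  rewrite /f !rising_opp_nat rising_2 [(-1) ^+ i * _ * _]mulrACA s2 mul1r factS !natrM.
  rewrite -bin_ffact natrM.
  have : i`!%:R != 0 :> R by rewrite pnatr_eq0 -lt0n fact_gt0.
  have : i.+1%:R != 0 :> R by rewrite pnatr_eq0.
  move: (i`!%:R) (i.+1%:R) => a b a0 b0.
  by field; rewrite a0 b0.
rewrite /hyp2F1 -/f; apply: lim_near_cst => //.
near=> n; rewrite /series /= (big_cat_nat (n := k.+1)) //=; last by near: n; exact: nbhs_infty_ge.
rewrite [X in _ + X = _]big_nat [X in _ + X = _]big1 ?addr0 => [|i /andP[ki _]].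
  by apply: eq_bigr => i _; exact: fE.
by rewrite fE bin_small // mul0r mul0r.
Unshelve. all: by end_near. Qed.

End Hypergeometric.

(** * The sum over all partitions for a fixed number of variables *)

Section Summation.
Variable R : realType.
Variables (theta t : R) (k : nat).
Hypotheses (theta_gt0 : 0 < theta) (t_gt0 : 0 < t).

Definition summand N l : R :=
  factorial_mean R N k l
        * expR (- ((N%:R + t) * theta))
        * (theta ^+ sumn l / (sumn l)`!%:R)
        * ((t * theta) ^+ (N - 1) / (N - 1)`!%:R)
        * schur1 R N l * (nb_syt l)%:R.

Let weight N : R := N.+1%:R^-1 * expR (- ((N.+1%:R + t) * theta))
  * ((t * theta) ^+ N / N`!%:R).

Let ttheta_ge0 : 0 <= t * theta. Proof. by rewrite mulr_ge0 // ltW. Qed.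

Lemma weight_ge0 N : 0 <= weight N.
Proof. by rewrite /weight !mulr_ge0 ?invr_ge0 ?ler0n ?expR_ge0 ?exprn_ge0. Qed.

Lemma summand_ge0 N l : 0 <= summand N l.
Proof.
have sum_ge0 : 0 <= \sum_(i < N) ((nth 0%N l i + (N - i.+1)) ^_ k)%:R :> R.
  by apply: sumr_ge0 => i _; rewrite ler0n.
by rewrite /summand schur1E !mulr_ge0 ?expR_ge0 ?invr_ge0 ?exprn_ge0 ?ler0n ?ttheta_ge0 // ltW.
Qed.

(** Without a bump, [psi] factors as the sum of falling factorials times [weyl], that is, times the
    Schur value; the averaging factor of the mean sits in [weight]. *)
Lemma summand_trim N n (m : {ffun 'I_N.+1 -> 'I_n.+1}) : is_shape n m ->
  summand N.+1 (trim_zeros (rowseq m)) = weight N * (theta ^+ n / n`!%:R)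
    * ((ssyt_count (pred1 1%N) n (rowseq m))%:R * psi R k 0 (pos (rowseq m) : 'I_N.+1 -> nat)).
Proof.
case/andP => hs /eqP ms; have ntrim := nth_trim hs.
have -> : psi R k 0 (pos (rowseq m) : 'I_N.+1 -> nat) =
    (\sum_(i < N.+1) (pos (rowseq m) i ^_ k)%:R) * @weyl R N.+1 (pos (rowseq m)).
  rewrite big_distrl; apply: eq_bigr => i _; congr (_ * _).
  by apply: eq_weyl => j; rewrite /bump_at mul0n addn0.
rewrite -ssyt_count_weyl; first last.
- exact: nth_rowseq_default.
- exact/sorted_geq_nth.
rewrite /summand /weight sumn_trim ms subn1 /= schur1E nb_syt_count sumn_trim ms.
rewrite !(eq_ssyt_count _ _ ntrim) /factorial_mean.
rewrite (eq_bigr (fun i : 'I_N.+1 => (pos (rowseq m) i ^_ k)%:R)); last first.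
  by move=> i _; rewrite ntrim.
by ring.
Qed.

Lemma walk_total N n : \sum_(m : {ffun 'I_N.+1 -> 'I_n.+1} | is_shape n m)
    summand N.+1 (trim_zeros (rowseq m))
  = weight N * (theta ^+ n / n`!%:R) * walk n n (@psi R N.+1 k 0).
Proof. by rewrite /walk big_distrr; apply: eq_bigr => m /summand_trim. Qed.

(** [sum_ffact] gives (N+1)^_(q+1) / (q+1), and (N+1)^_(q+1) = (N+1) N^_q absorbs the averaging
    factor. *)
Lemma mean_ffact N q : N.+1%:R^-1 * (\sum_(0 <= s < N.+1) s ^_ q)%:R
  = (N ^_ q)%:R / q.+1%:R :> R.
Proof.
have /(congr1 (fun n => n%:R : R)) := sum_ffact N.+1 q.
rewrite ffactSS !natrM => e.
have N0 : N.+1%:R != 0 :> R by rewrite pnatr_eq0.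
have q0 : q.+1%:R != 0 :> R by rewrite pnatr_eq0.
by apply: (mulfI N0); apply: (mulfI q0); rewrite mulVKf // e; field.
Qed.

(** Summing over the weight n produces e^((N+1) theta), which cancels part of the prefactor and
    leaves e^(-t theta); [mean_ffact] brings the trace to the form [N ^_ q], ready for the sum over
    N. *)
Lemma sum_over_partitions N :
  (\esum_(l in [set l : seq nat | is_part l]%classic) (summand N.+1 l)%:E)%E
  = (expR (- (t * theta)) * \sum_(0 <= q < k.+1)
      theta ^+ k * ('C(k, q) ^ 2)%:R / (q.+1%:R * theta ^+ q)
       * ((t * theta) ^+ N / N`!%:R * (N ^_ q)%:R))%:E.
Proof.
rewrite (esum_partitions (N := N)); last 2 first.
- by move=> l; rewrite lee_fin summand_ge0.
- move=> l /andP[sl l0] lN; rewrite /summand schur1E ssyt_count_too_long ?mulr0 ?mul0r //.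
    exact/sorted_geq_nth.
  rewrite lt0n; apply: contraNneq l0 => <-; exact: mem_nth.
(* [D r] is psi_{k-r,r} at the staircase. In [c r], the power (N+1)^r is divided out because
   [walk_psi] has (N+1)^(n-r), while the series variable (N+1) theta takes all of (N+1)^n. *)
pose D r := (\sum_(0 <= s < N.+1) s ^_ (k - r) * 'C(k, k - r))%:R : R.
pose c r := weight N * 'C(k, r)%:R * D r / N.+1%:R ^+ r.
rewrite (eq_eseriesr (g := fun n => (\sum_(0 <= r < k.+1)
    c r * ((N.+1%:R * theta) ^+ n / n`!%:R * (n ^_ r)%:R))%:E)); last first.
  move=> n _; rewrite sumEFin walk_total walk_psi // big_distrr /=; congr EFin.
  apply: eq_big_nat => r; rewrite ltnS => /andP[_ rk].
  rewrite add0n psi_staircase subnK // -/(D r) /c.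
  case: (leqP r n) => rn; last first.
    by rewrite bin_small // [(n ^_ r)%N]ffact_small // !mul0n mul0r !mulr0.
  have -> : ('C(n, r) * k ^_ r = n ^_ r * 'C(k, r))%N by rewrite -!bin_ffact mulnA mulnAC.
  rewrite !natrM natrX exprMn.
  have -> : N.+1%:R ^+ n = N.+1%:R ^+ (n - r) * N.+1%:R ^+ r :> R by rewrite -exprD subnK.
  have : N.+1%:R ^+ r != 0 :> R by rewrite expf_neq0 // pnatr_eq0.
  move: (N.+1%:R ^+ r) (_ ^+ (n - r)) => a b a0.
  have n0 : n`!%:R != 0 :> R by rewrite pnatr_eq0 -lt0n fact_gt0.
  by field; rewrite a0 n0.
have N0 : N.+1%:R != 0 :> R by rewrite pnatr_eq0.
rewrite exp_series_sum; last 2 first.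
- by rewrite mulr_ge0 ?ler0n ?ltW.
- by move=> r; rewrite /c !mulr_ge0 ?weight_ge0 ?invr_ge0 ?exprn_ge0 ?ler0n.
congr EFin; rewrite big_distrl big_distrr /=.
(* The two indices are related by q = k - r. *)
rewrite [RHS]big_nat_rev /=; apply: eq_big_nat => r; rewrite ltnS => /andP[_ rk].
rewrite add0n subSS bin_sub // /c /D -big_distrl natrM /= exprMn bin_sub //.
have -> : weight N = N.+1%:R^-1 * expR (- (N.+1%:R * theta)) * expR (- (t * theta))
    * ((t * theta) ^+ N / N`!%:R).
  by rewrite /weight mulrDl opprD expRD !mulrA.
rewrite expRN -[expR (N.+1%:R * _)]/(expR (N.+1%:R * theta)).
have E0 : expR (N.+1%:R * theta) != 0 :> R by rewrite gt_eqF // expR_gt0.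
have a0 : N.+1%:R ^+ r != 0 :> R by rewrite expf_neq0.
have := mean_ffact N (k - r); set S := (\sum_(0 <= _ < _) _)%N => mE.
have -> : theta ^+ k = theta ^+ r * theta ^+ (k - r) by rewrite -exprD subnKC.
have th0 : theta ^+ (k - r) != 0 by rewrite expf_neq0 // gt_eqF.
rewrite natrX.
transitivity (expR (- (t * theta)) * (theta ^+ r * 'C(k, r)%:R ^+ 2
   * (N.+1%:R^-1 * S%:R) * ((t * theta) ^+ N / N`!%:R))).
  have f0 : N`!%:R != 0 :> R by rewrite pnatr_eq0 -lt0n fact_gt0.
  by field; rewrite f0 nat1r N0 a0 E0.
rewrite mE; have q0 : (k - r).+1%:R != 0 :> R by rewrite pnatr_eq0.
have f0 : N`!%:R != 0 :> R by rewrite pnatr_eq0 -lt0n fact_gt0.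
by field; rewrite ?nat1r f0 th0 q0.
Qed.

End Summation.

Unset Implicit Arguments.

Local Open Scope classical_set_scope.
Local Open Scope ring_scope.

(* Both sums have nonnegative terms and are taken in the extended reals, so the
   equality with a finite value also asserts their convergence. *)
Theorem corollary7 (R : realType) (theta t : R) (k : nat)
    (theta_gt0 : 0 < theta) (t_gt0 : 0 < t) :
  (\sum_(1 <= N <oo)
     \esum_(l in [set l : seq nat | is_part l])
       (factorial_mean R N k l
        * expR (- ((N%:R + t) * theta))
        * (theta ^+ sumn l / (sumn l)`!%:R)
        * ((t * theta) ^+ (N - 1) / (N - 1)`!%:R)
        * schur1 R N l * (nb_syt l)%:R)%:E)%E
  = (theta ^+ k * hyp2F1 (- k%:R) (- k%:R) 2 t)%:E.
Proof.
have theta_ge0 := ltW theta_gt0; have t_ge0 := ltW t_gt0.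
rewrite -nneseries_addn; last first.
  by move=> N; apply: esum_ge0 => l _; rewrite lee_fin (summand_ge0 k theta_gt0 t_gt0).
(* Summing over N turns the factor of [c q] into (t theta)^q e^(t theta); the exponentials and
   theta^q cancel, leaving theta^k C(k, q)^2 t^q / (q + 1). *)
pose c q := expR (- (t * theta)) * (theta ^+ k * ('C(k, q) ^ 2)%:R / (q.+1%:R * theta ^+ q)).
rewrite (eq_eseriesr (g := fun N => (\sum_(0 <= q < k.+1)
    c q * ((t * theta) ^+ N / N`!%:R * (N ^_ q)%:R))%:E)); last first.
  move=> N _; rewrite addn1 (sum_over_partitions k theta_gt0 t_gt0) big_distrr /=.
  by congr EFin; apply: eq_bigr => q _; rewrite /c !mulrA.
rewrite exp_series_sum; last 2 first.
- by rewrite mulr_ge0.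
- by move=> q; rewrite /c !mulr_ge0 ?expR_ge0 ?invr_ge0 ?mulr_ge0 ?exprn_ge0 ?ler0n.
rewrite hyp2F1_opp_nat big_distrl big_distrr /=; congr EFin; apply: eq_bigr => q _.
rewrite /c expRN exprMn.
have E0 : expR (t * theta) != 0 by rewrite gt_eqF // expR_gt0.
have th0 : theta ^+ q != 0 by rewrite expf_neq0 // gt_eqF.
have q0 : q.+1%:R != 0 :> R by rewrite pnatr_eq0.
by field; rewrite ?nat1r E0 th0 q0.
Qed.
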